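(* Let $s\ge 1$, and for each $i=1,\dots,s$ let $f_{i,1},\dots,f_{i,t_i}\in\mathbf{F}_2[x_1,\dots,x_n]$ be finitely many polynomials. Let $V_i=\{a\in\mathbf{F}_2^n : f_{i,1}(a)=\dots=f_{i,t_i}(a)=0\}$ and $V_F=\bigcup_{i=1}^s V_i\subset\mathbf{F}_2^n$. Define the ideals $$I_i=\langle f_{i,1},\dots,f_{i,t_i},\,x_1^2+x_1,\dots,x_n^2+x_n\rangle\subset\mathbf{F}_2[x_1,\dots,x_n],\qquad I'=\prod_{i=1}^s I_i .$$ If the ideals $I_1,\dots,I_s$ are radical and pairwise coprime, then $I'=I(V_F)$.
   Context: $\mathbf{F}_2$ is the field with two elements. For $V\subset\mathbf{F}_2^n$, $I(V)\subset\mathbf{F}_2[x_1,\dots,x_n]$ denotes the ideal of all polynomials vanishing at every point of $V$. Ideals $I_i,I_j$ are coprime if $I_i+I_j=\langle 1\rangle$; pairwise coprime means this holds for all $i\neq j$. (In the application, $f_{i,1}=\dots=f_{i,t_i}=0$ are the equations in row $i$ of a truth table with $s$ rows.) *)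

(* Defs.v *)
From mathcomp Require Import all_boot all_order all_algebra.
From mathcomp Require Export mpoly.

Set Implicit Arguments.
Unset Strict Implicit.
Unset Printing Implicit Defensive.

Import GRing.Theory.
Local Open Scope ring_scope.

(* Ideals are Prop-valued predicates, compared pointwise with <->.  The       *)
(* library predicate idealr_closed cannot be used: it requires 1 \notin I,    *)
(* whereas the unit ideal must be allowed here.                               *)
Section Ideals.
Variable R : comNzRingType.
Implicit Types I J : R -> Prop.

Definition ideal_gen (gs : seq R) : R -> Prop :=
  fun p => exists c : 'I_(size gs) -> R, p = \sum_(k < size gs) c k * gs`_k.

Definition ideal_unit : R -> Prop := ideal_gen [:: 1].

Definition ideal_add I J : R -> Prop :=
  fun p => exists a b : R, [/\ I a, J b & p = a + b].

Definition ideal_mul I J : R -> Prop :=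
  fun p => exists m (a b : 'I_m -> R),
    (forall k, I (a k) /\ J (b k)) /\ p = \sum_(k < m) a k * b k.

(* The empty product is the unit ideal. *)
Definition ideal_prod s (I : 'I_s -> R -> Prop) : R -> Prop :=
  \big[ideal_mul/ideal_unit]_(i < s) I i.

Definition radical_ideal I : Prop :=
  forall (p : R) (m : nat), (0 < m)%N -> I (p ^+ m) -> I p.

Definition coprime_ideals I J : Prop :=
  forall p : R, ideal_add I J p <-> ideal_unit p.

End Ideals.

Section BooleanPoints.
Variable n : nat.

Definition zero_set (gs : seq {mpoly 'F_2[n]}) : {set {ffun 'I_n -> 'F_2}} :=
  [set a : {ffun 'I_n -> 'F_2} | all (fun g : {mpoly 'F_2[n]} => g.@[a] == 0) gs].

Definition vanishing_ideal (V : {set {ffun 'I_n -> 'F_2}}) :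
    {mpoly 'F_2[n]} -> Prop :=
  fun p => forall a, a \in V -> p.@[a] = 0.

Definition field_polys : seq {mpoly 'F_2[n]} :=
  [seq 'X_k ^+ 2 + 'X_k | k : 'I_n].

End BooleanPoints.

(* Main.v *)
(** Modulo the field equations the polynomials
    [delta_a = \prod_k (1 + X_k + a_k)] sum to 1 and satisfy
    [q * delta_a = q(a) * delta_a].  If [p] vanishes on [V_i], split it as
    [\sum_a p * delta_a]: a summand with [p(a) = 0] lies in the ideal of the
    field equations, and if [p(a) <> 0] some generator [g] of [I_i] has
    [g(a) = 1], so that [delta_a], being congruent to [g * delta_a], lies in
    [I_i].  Hence [p] lies in every [I_i], and for pairwise coprime ideals the
    intersection is contained in the product. *)
Require Import Defs.
From mathcomp Require Import all_boot all_order all_algebra.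
From mathcomp Require Import ring.

Set Implicit Arguments.
Unset Strict Implicit.
Unset Printing Implicit Defensive.

Import GRing.Theory.

(** * Sums and products of ideals in a commutative ring *)

Section IdealTheory.
Local Open Scope ring_scope.
Variable R : comNzRingType.
Implicit Types (gs : seq R) (p q : R) (K : R -> Prop).

Lemma ideal_gen0 gs : ideal_gen gs 0.
Proof. by exists (fun=> 0); rewrite big1 // => k _; rewrite mul0r. Qed.

Lemma ideal_genD gs p q : ideal_gen gs p -> ideal_gen gs q -> ideal_gen gs (p + q).
Proof.
move=> [c ->] [d ->]; exists (fun k => c k + d k).
by rewrite -big_split; apply: eq_bigr => k _; rewrite mulrDl.
Qed.

Lemma ideal_genMl gs p q : ideal_gen gs q -> ideal_gen gs (p * q).
Proof.
move=> [c ->]; exists (fun k => p * c k).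
by rewrite mulr_sumr; apply: eq_bigr => k _; rewrite mulrA.
Qed.

Lemma ideal_genMr gs p q : ideal_gen gs p -> ideal_gen gs (p * q).
Proof. by rewrite mulrC; apply: ideal_genMl. Qed.

Lemma mem_ideal_gen gs p : p \in gs -> ideal_gen gs p.
Proof.
move=> gs_p; have lt_i: (index p gs < size gs)%N by rewrite index_mem.
exists (fun k => (k == Ordinal lt_i)%:R).
rewrite (bigD1 (Ordinal lt_i)) //= eqxx mul1r nth_index // big1 ?addr0 //.
by move=> k /negPf->; rewrite mul0r.
Qed.

Lemma ideal_gen_min gs gs' p :
  {in gs, forall g, ideal_gen gs' g} -> ideal_gen gs p -> ideal_gen gs' p.
Proof.
move=> sub [c ->]; elim/big_ind: _ => [||k _]; first exact: ideal_gen0.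
  exact: ideal_genD.
by apply/ideal_genMl/sub/mem_nth.
Qed.

Lemma ideal_unit1 : ideal_unit (1 : R).
Proof. by apply: mem_ideal_gen; rewrite inE. Qed.

Lemma ideal_unitT p : ideal_unit p.
Proof. by rewrite -[p]mulr1; apply/ideal_genMl/ideal_unit1. Qed.

Lemma ideal_mul_in I J p q : I p -> J q -> @ideal_mul R I J (p * q).
Proof. by move=> Ip Jq; exists 1%N, (fun=> p), (fun=> q); rewrite big_ord1. Qed.

(** If 1 = a + b with a in [I] and b in [J], then p = a * p + p * b, where each summand has its left
    factor in [I] and its right factor in [J]. *)
Lemma coprime_cap_mul I J p :
  @ideal_add R I J 1 -> I p -> J p -> ideal_mul I J p.
Proof.
move=> [a [b [Ia Jb def1]]] Ip Jp.
exists 2%N, (fun k => if k == 0 then a else p), (fun k => if k == 0 then p else b).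
split; first by move=> k; case: ifP.
by rewrite big_ord_recl big_ord1 /= -{1}[p]mulr1 def1; ring.
Qed.

Section Families.
Variables (T : eqType) (I : T -> R -> Prop).

(** Coprimality to [K] passes to products: 1 = a + b and 1 = a' + b' combine into 1 = (a + b * a') +
    b * b'. *)
Lemma coprime_big_mul K (r : seq T) :
    (forall p q, K p -> K q -> K (p + q)) -> (forall p q, K q -> K (p * q)) ->
    K 0 -> {in r, forall i, ideal_add K (I i) 1} ->
  ideal_add K (\big[@ideal_mul R/@ideal_unit R]_(i <- r) I i) 1.
Proof.
move=> KD KM K0; elim: r => [|i r IHr] coKr.
  by exists 0, 1; rewrite big_nil add0r; split=> //; apply: ideal_unit1.
have [a [b [Ka Ib def1]]] := coKr i (mem_head _ _).
have [j r_j|a' [b' [Ka' Jb' def1']]] := IHr.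
  by apply: coKr; rewrite inE r_j orbT.
exists (a + b * a'), (b * b'); rewrite big_cons; split.
- by apply: KD; last apply: KM.
- exact: ideal_mul_in.
- by rewrite -addrA -mulrDr -def1' mulr1.
Qed.

(** Induction on [r]: the head ideal is coprime to the product of the others, so the case of two
    ideals applies. Uniqueness of the indices makes the head differ from every later index. *)
Lemma bigcap_sub_big_mul (r : seq T) p :
    uniq r ->
    (forall i p q, I i p -> I i q -> I i (p + q)) ->
    (forall i p q, I i q -> I i (p * q)) -> (forall i, I i 0) ->
    (forall i j, i != j -> ideal_add (I i) (I j) 1) ->
    {in r, forall i, I i p} ->
  (\big[@ideal_mul R/@ideal_unit R]_(i <- r) I i) p.
Proof.
move=> + ID IM I0 coI; elim: r => [|i r IHr] /=.
  by move=> _ _; rewrite big_nil; apply: ideal_unitT.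
case/andP=> r'i uniq_r Ip; rewrite big_cons; apply: coprime_cap_mul.
- apply: coprime_big_mul => //; [exact: ID | exact: IM|].
  by move=> j r_j; apply: coI; apply: contraNneq r'i => ->.
- exact/Ip/mem_head.
- by apply: IHr => // j r_j; apply: Ip; rewrite inE r_j orbT.
Qed.

(** Serves the easy inclusion, with [phi] the evaluation at a point of V_i: one vanishing factor
    kills the whole product. *)
Lemma big_mul_vanish (S : nzRingType) (phi : {rmorphism R -> S}) (r : seq T) i p :
    i \in r -> (forall q, I i q -> phi q = 0) ->
  (\big[@ideal_mul R/@ideal_unit R]_(j <- r) I j) p -> phi p = 0.
Proof.
move=> + phi0; elim: r p => [|j r IHr] p //; rewrite inE big_cons.
move=> r_i [m [a [b [abP ->]]]]; rewrite rmorph_sum big1 // => k _.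
have [Ia Jb] := abP k; rewrite rmorphM.
case/orP: r_i => [/eqP eij|r_i]; first by rewrite phi0 ?mul0r ?eij.
by rewrite [phi (b k)]IHr ?mulr0.
Qed.

End Families.

End IdealTheory.

(** * Interpolation at the points of the Boolean cube *)

Section BooleanNullstellensatz.
Local Open Scope ring_scope.
Variable n : nat.
Implicit Types (p q : {mpoly 'F_2[n]}) (a : {ffun 'I_n -> 'F_2}).

Lemma F2_cases (x : 'F_2) : x = 0 \/ x = 1.
Proof. by case: x => [[|[|//]] ?]; [left | right]; apply: val_inj. Qed.

(** The Lagrange polynomial of [a]: on Boolean points, the factor at [k] is 1 exactly where the
    coordinate equals [a k]. *)
Definition delta_pt a : {mpoly 'F_2[n]} := \prod_k (1 + 'X_k + (a k)%:MP).

(** By distributivity the sum is a product over [k] of sums over the two values of [a k], each equal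
    to 1. The identity holds in the polynomial ring itself. *)
Lemma sum_delta_pt : \sum_a delta_pt a = 1.
Proof.
rewrite /delta_pt.
rewrite -(bigA_distr_bigA (fun (k : 'I_n) (c : 'F_2) => 1 + 'X_k + c%:MP)) /=.
apply: big1 => k _.
have F2E: \sum_(c : 'F_2) (1 + 'X_k + c%:MP) =
          (1 + 'X_k + 0%:MP) + (1 + 'X_k + 1%:MP) :> {mpoly 'F_2[n]}.
  rewrite (bigD1 0) //= (bigD1 1) //= big1 ?addr0 // => c.
  by case: (F2_cases c) => ->; rewrite ?eqxx ?andbF.
have char2: 2%:R = 0 :> {mpoly 'F_2[n]}.
  by rewrite -mpolyC_nat (_ : 2%:R = 0) ?mpolyC0 //; apply: val_inj.
rewrite F2E mpolyC0 mpolyC1.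
(* [ring] ignores the characteristic, so the multiple of 2 is isolated first. *)
by transitivity (1 + 2%:R * (1 + 'X_k) : {mpoly 'F_2[n]}); [ring | rewrite char2; ring].
Qed.

(** Only the factor at [k] matters: its product with X_k - a_k is X_k^2 + X_k - (a_k + a_k^2), and
    a_k + a_k^2 = 0 in F_2. *)
Lemma mulX_delta_pt a k :
  ideal_gen (field_polys n) (('X_k - (a k)%:MP) * delta_pt a).
Proof.
rewrite /delta_pt (bigD1 k) //= mulrA; apply: ideal_genMr.
have -> : ('X_k - (a k)%:MP) * (1 + 'X_k + (a k)%:MP) = 'X_k ^+ 2 + 'X_k
          :> {mpoly 'F_2[n]}.
  have ak2: (a k)%:MP * (a k)%:MP = - (a k)%:MP :> {mpoly 'F_2[n]}.
    rewrite -mpolyCM -mpolyCN; congr (_%:MP).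
    by case: (F2_cases (a k)) => ->; apply: val_inj.
  transitivity ('X_k ^+ 2 + 'X_k - ((a k)%:MP + (a k)%:MP * (a k)%:MP)
                : {mpoly 'F_2[n]}); first by ring.
  by rewrite ak2 subrr subr0.
by apply/mem_ideal_gen/map_f; rewrite mem_enum.
Qed.

(** The property holds for constants and variables and is stable under sums and products, hence
    holds for every polynomial. *)
Lemma mul_delta_pt a q :
  ideal_gen (field_polys n) ((q - q.@[a]%:MP) * delta_pt a).
Proof.
pose P q := ideal_gen (field_polys n) ((q - q.@[a]%:MP) * delta_pt a).
have PC c : P c%:MP by rewrite /P mevalC subrr mul0r; apply: ideal_gen0.
have PD p1 p2 : P p1 -> P p2 -> P (p1 + p2).
  rewrite /P => Pp1 Pp2; have := ideal_genD Pp1 Pp2.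
  by rewrite mevalD mpolyCD; congr ideal_gen; ring.
have PM p1 p2 : P p1 -> P p2 -> P (p1 * p2).
  rewrite /P => Pp1 Pp2.
  (* p1 p2 - p1(a) p2(a) = p2 (p1 - p1(a)) + p1(a) (p2 - p2(a)). *)
  have := ideal_genD (ideal_genMl p2 Pp1) (ideal_genMl (p1.@[a])%:MP Pp2).
  by rewrite mevalM mpolyCM; congr ideal_gen; ring.
have PX m : P 'X_[m].
  rewrite mpolyXE_id; elim/big_ind: _ => [||k _]; first exact: (PC 1).
    exact: PM.
  elim: (m k) => [|e IHe]; first exact: (PC 1).
  rewrite exprS; apply: PM => //.
  by rewrite /P mevalXU; apply: mulX_delta_pt.
elim/mpolyind: q => [|c m q _ _ Pq]; first exact: (PC 0).
by apply: PD => //; rewrite -mul_mpolyC; apply: PM.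
Qed.

Lemma vanishing_ideal_sub (gs : seq {mpoly 'F_2[n]}) p :
  vanishing_ideal (zero_set gs) p -> ideal_gen (gs ++ field_polys n) p.
Proof.
move=> p0; rewrite -[p]mulr1 -sum_delta_pt mulr_sumr.
elim/big_ind: _ => [||a _]; [exact: ideal_gen0 | exact: ideal_genD|].
have Jsub q : ideal_gen (field_polys n) q -> ideal_gen (gs ++ field_polys n) q.
  by apply: ideal_gen_min => g g_in; apply: mem_ideal_gen; rewrite mem_cat g_in orbT.
have [Va|] := boolP (a \in zero_set gs).
  by have := mul_delta_pt a p; rewrite p0 // mpolyC0 subr0 => /Jsub.
rewrite inE => /allPn[g gs_g ga]; apply: ideal_genMl.
have {ga} ga: g.@[a] = 1 by case: (F2_cases g.@[a]) ga => ->.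
have Ig: ideal_gen (gs ++ field_polys n) g.
  by apply: mem_ideal_gen; rewrite mem_cat gs_g.
(* Since g(a) = 1, delta_a = g * delta_a - (g - g(a)) * delta_a. *)
have := ideal_genD (ideal_genMr (delta_pt a) Ig)
                   (ideal_genMl (-1) (Jsub _ (mul_delta_pt a g))).
by rewrite ga mpolyC1; congr ideal_gen; ring.
Qed.

Lemma ideal_gen_vanish (gs : seq {mpoly 'F_2[n]}) a p :
  a \in zero_set gs -> ideal_gen (gs ++ field_polys n) p -> p.@[a] = 0.
Proof.
rewrite inE => /allP ga [c ->]; rewrite rmorph_sum big1 // => k _.
rewrite rmorphM /=; have := mem_nth 0 (ltn_ord k).
move: (_`_k) => g; rewrite mem_cat => /orP[/ga/eqP->|]; first by rewrite mulr0.
case/mapP=> j _ ->; rewrite mevalD rmorphXn /= mevalXU.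
suff ->: a j ^+ 2 + a j = 0 by rewrite mulr0.
by case: (F2_cases (a j)) => ->; apply: val_inj.
Qed.

End BooleanNullstellensatz.

Theorem theorem2 (n s : nat) (t : 'I_s -> nat)
    (f : forall i : 'I_s, (t i).-tuple {mpoly 'F_2[n]}) :
  (0 < s)%N ->
  let VF : {set {ffun 'I_n -> 'F_2}} := \bigcup_(i < s) zero_set (f i) in
  let I (i : 'I_s) : {mpoly 'F_2[n]} -> Prop :=
    ideal_gen (f i ++ field_polys n) in
  (forall i : 'I_s, radical_ideal (I i)) ->
  (forall i j : 'I_s, i != j -> coprime_ideals (I i) (I j)) ->
  forall p : {mpoly 'F_2[n]}, ideal_prod I p <-> vanishing_ideal VF p.
Proof.
move=> _ VF I _ coI p; split=> [Ip a /bigcupP[i _ Via]|p0].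
  apply: (big_mul_vanish (phi := meval a) (mem_index_enum i) _ Ip) => q.
  exact: ideal_gen_vanish.
apply: bigcap_sub_big_mul => [|i|i|i|i j /coI coij|i _].
- exact: index_enum_uniq.
- exact: ideal_genD.
- exact: ideal_genMl.
- exact: ideal_gen0.
- exact/coij/ideal_unit1.
- apply: vanishing_ideal_sub => a Via; apply: p0.
  by apply/bigcupP; exists i.
Qed.
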